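(* Let $\mathcal{C}$ be a small strict monoidal Ab-category and let $S_0$ be an infinite set. Then the category $\mathcal{C}^{S_0}$, with the tensor product of objects and morphisms, unit object $\mathrm{I}$, associativity constraint $A$, and right and left units $R$ and $L$ defined in the context, is a monoidal category.
   Context: An Ab-category is a category whose hom-sets are additive abelian groups with bilinear composition; in a monoidal Ab-category the tensor product of morphisms is also assumed bilinear. The category $\mathcal{C}^{S_0}$. Objects are functions $f:S_f\to \mathrm{Obj}(\mathcal{C})$ with $S_f\subset S_0$ any subset. A morphism $F:f\to g$ is a function on $S_f\times S_g$ assigning to $(x,y)$ a morphism $F(x,y):f(x)\to g(y)$ of $\mathcal{C}$ such that, if $S_g$ is infinite, for each $x\in S_f$ there is a finite set $S^F_x\subset S_g$ with $F(x,y)=0$ for $y\in S_g\setminus S_x^F$. Composition is $(G\circ F)(x,y)=\sum_{z\in S_g}G(z,y)\circ F(x,z)$; identities are $\mathrm{Id}_f(x,y)=\delta_{x,y}\mathrm{id}_{f(x)}$ (here and below, $\delta$ times a morphism means that morphism when the indices agree and the zero morphism otherwise). Monoidal structure. Fix a bijection $\gamma:S_0\times S_0\to S_0$ and a point $\ast\in S_0$. For objects $f,g$, $f\otimes g:\gamma(S_f\times S_g)\to\mathrm{Obj}(\mathcal{C})$ is $(f\otimes g)(\gamma(x,y))=f(x)\otimes g(y)$. The unit object is $\mathrm{I}:\{\ast\}\to \mathrm{Obj}(\mathcal{C})$, $\ast\mapsto \mathrm{I}$. For morphisms $F:f\to f'$, $G:g\to g'$, $(F\otimes G)(\gamma(x,y),\gamma(x',y'))=F(x,x')\otimes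 G(y,y')$. The associativity constraint $A_{f,g,h}:(f\otimes g)\otimes h\to f\otimes(g\otimes h)$ is $A_{f,g,h}(\gamma(\gamma(x,y),z),\gamma(x',\gamma(y',z')))=\delta_{x,x'}\delta_{y,y'}\delta_{z,z'}\mathrm{id}_{f(x)\otimes g(y)\otimes h(z)}$; the units $R_f:f\otimes\mathrm{I}\to f$, $L_f:\mathrm{I}\otimes f\to f$ are $R_f(\gamma(x,\ast),x')=\delta_{x,x'}\mathrm{id}_{f(x)}$ and $L_f(\gamma(\ast,x),x')=\delta_{x,x'}\mathrm{id}_{f(x)}$. *)

(* Defs.v *)
From HB Require Import structures.
From mathcomp Require Import all_boot all_order all_algebra.
From mathcomp Require Import all_classical.
Set Implicit Arguments.
Unset Strict Implicit.
Unset Printing Implicit Defensive.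
Import GRing.Theory.
Local Open Scope classical_set_scope.
Local Open Scope ring_scope.

Reserved Notation "g <o> f" (at level 40, left associativity).
Reserved Notation "a <x> b" (at level 40, left associativity).
Reserved Notation "f <#> g" (at level 40, left associativity).

Record precategory := Precategory {
  ob :> Type;
  hom : ob -> ob -> Type;
  idm : forall a, hom a a;
  comp : forall a b c, hom b c -> hom a b -> hom a c }.
Arguments hom {_} _ _.
Arguments idm {_} _.
Arguments comp {_ _ _ _} _ _.
Notation "g <o> f" := (comp g f).

Record is_category (C : precategory) : Prop := IsCategory {
  compA : forall (a b c d : C) (h : hom c d) (g : hom b c) (f : hom a b),
    h <o> (g <o> f) = (h <o> g) <o> f;
  comp_idl : forall (a b : C) (f : hom a b), idm b <o> f = f;
  comp_idr : forall (a b : C) (f : hom a b), f <o> idm a = f }.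

Definition is_iso (C : precategory) (a b : C) (f : hom a b) : Prop :=
  exists g : hom b a, g <o> f = idm a /\ f <o> g = idm b.

(* The identity of [a], regarded as a morphism to an equal object. *)
Definition idto (C : precategory) (a b : C) (e : a = b) : hom a b :=
  match e in _ = c return hom a c with erefl => idm a end.

Record premonoidal := Premonoidal {
  pm_cat :> precategory;
  tob : pm_cat -> pm_cat -> pm_cat;
  thom : forall a b a' b' : pm_cat,
    hom a a' -> hom b b' -> hom (tob a b) (tob a' b');
  munit : pm_cat;
  assoc : forall a b c : pm_cat, hom (tob (tob a b) c) (tob a (tob b c));
  runit : forall a : pm_cat, hom (tob a munit) a;
  lunit : forall a : pm_cat, hom (tob munit a) a }.
Arguments tob {_} _ _.
Arguments thom {_ _ _ _ _} _ _.
Arguments munit {_}.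
Arguments assoc {_} _ _ _.
Arguments runit {_} _.
Arguments lunit {_} _.
Notation "a <x> b" := (tob a b).
Notation "f <#> g" := (thom f g).

Record is_monoidal (C : premonoidal) : Prop := IsMonoidal {
  monoidal_category : is_category C;
  tensor_id : forall a b : C, idm a <#> idm b = idm (a <x> b);
  tensor_comp : forall (a b c a' b' c' : C)
      (g : hom b c) (f : hom a b) (g' : hom b' c') (f' : hom a' b'),
    (g <o> f) <#> (g' <o> f') = (g <#> g') <o> (f <#> f');
  assoc_iso : forall a b c : C, is_iso (assoc a b c);
  runit_iso : forall a : C, is_iso (runit a);
  lunit_iso : forall a : C, is_iso (lunit a);
  assoc_natural : forall (a b c a' b' c' : C)
      (f : hom a a') (g : hom b b') (h : hom c c'),
    assoc a' b' c' <o> ((f <#> g) <#> h) =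
    (f <#> (g <#> h)) <o> assoc a b c;
  runit_natural : forall (a a' : C) (f : hom a a'),
    runit a' <o> (f <#> idm munit) = f <o> runit a;
  lunit_natural : forall (a a' : C) (f : hom a a'),
    lunit a' <o> (idm munit <#> f) = f <o> lunit a;
  pentagon : forall a b c d : C,
    (idm a <#> assoc b c d) <o> assoc a (b <x> c) d <o>
      (assoc a b c <#> idm d) =
    assoc a b (c <x> d) <o> assoc (a <x> b) c d;
  triangle : forall a b : C,
    (idm a <#> lunit b) <o> assoc a munit b = runit a <#> idm b }.

Record is_strict (C : premonoidal) : Prop := IsStrict {
  strict_obA : forall a b c : C, (a <x> b) <x> c = a <x> (b <x> c);
  strict_ob1r : forall a : C, a <x> munit = a;
  strict_ob1l : forall a : C, munit <x> a = a;
  strict_assoc : forall a b c : C, assoc a b c = idto (strict_obA a b c);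
  strict_runit : forall a : C, runit a = idto (strict_ob1r a);
  strict_lunit : forall a : C, lunit a = idto (strict_ob1l a) }.

Record premonoidal_ab := PremonoidalAb {
  pab_mon :> premonoidal;
  hom_zmod : forall a b : pab_mon, GRing.Zmodule (hom a b) }.

HB.instance Definition _ (C : premonoidal_ab) (a b : C) := @hom_zmod C a b.

Record is_monoidal_ab (C : premonoidal_ab) : Prop := IsMonoidalAb {
  monoidal_ab_monoidal : is_monoidal C;
  compDl : forall (a b c : C) (g g' : hom b c) (f : hom a b),
    (g + g') <o> f = g <o> f + g' <o> f;
  compDr : forall (a b c : C) (g : hom b c) (f f' : hom a b),
    g <o> (f + f') = g <o> f + g <o> f';
  tensorDl : forall (a b a' b' : C) (f f' : hom a a') (g : hom b b'),
    (f + f') <#> g = f <#> g + f' <#> g;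
  tensorDr : forall (a b a' b' : C) (f : hom a a') (g g' : hom b b'),
    f <#> (g + g') = f <#> g + f <#> g' }.

Record strict_monoidal_ab := StrictMonoidalAb {
  sma_data :> premonoidal_ab;
  sma_monoidal_ab : is_monoidal_ab sma_data;
  sma_strict : is_strict sma_data }.

Section StrictMonoidalAbTheory.
Variable C : strict_monoidal_ab.
Implicit Types a b c : C.

Lemma comp0l a b c (f : hom a b) : (0 : hom b c) <o> f = 0.
Proof.
have := compDl (sma_monoidal_ab C) (0 : hom b c) 0 f.
by rewrite addr0 => /(congr1 (fun h => h - 0 <o> f)); rewrite subrr addrK.
Qed.

Lemma comp0r a b c (g : hom b c) : g <o> (0 : hom a b) = 0.
Proof.
have := compDr (sma_monoidal_ab C) g (0 : hom a b) 0.
by rewrite addr0 => /(congr1 (fun h => h - g <o> 0)); rewrite subrr addrK.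
Qed.

Lemma tensor0l a b a' b' (g : hom b b') : (0 : hom a a') <#> g = 0.
Proof.
have := tensorDl (sma_monoidal_ab C) (0 : hom a a') 0 g.
by rewrite addr0 => /(congr1 (fun h => h - 0 <#> g)); rewrite subrr addrK.
Qed.

Lemma tensor0r a b a' b' (f : hom a a') : f <#> (0 : hom b b') = 0.
Proof.
have := tensorDr (sma_monoidal_ab C) f (0 : hom b b') 0.
by rewrite addr0 => /(congr1 (fun h => h - f <#> 0)); rewrite subrr addrK.
Qed.

End StrictMonoidalAbTheory.

(* [delta m] is [m] if [P] holds and zero otherwise; [m] may use the proof of
   [P], so that it can be an identity transported along an index equality. *)
Definition delta (P : Prop) (M : zmodType) (m : P -> M) : M :=
  if pselect P is left p then m p else 0.

Lemma deltaF (P : Prop) (M : zmodType) (m : P -> M) : ~ P -> delta m = 0.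
Proof. by rewrite /delta; case: pselect. Qed.

Section FunctionCategory.
Variables (C : strict_monoidal_ab) (S0 : choiceType).

Record fob := Fob { supp : set S0; fam :> supp -> C }.

(* A subset of S_g is represented as a [set] of the subtype [supp g]. *)
Definition row_finite (f g : fob) (F : forall x y, hom (f x) (g y)) : Prop :=
  infinite_set (supp g) -> forall x : supp f,
    exists2 A : set (supp g), finite_set A & forall y, ~ A y -> F x y = 0.

Record fhom (f g : fob) := Fhom {
  entry :> forall (x : supp f) (y : supp g), hom (f x) (g y);
  entry_finite : row_finite entry }.

Lemma row_finiteP (f g : fob) (F : forall x y, hom (f x) (g y)) :
  row_finite F <-> forall x : supp f,
    exists2 A : set (supp g), finite_set A & forall y, ~ A y -> F x y = 0.
Proof.
split=> [Ffin x|Ffin _ //]; have [gfin|/Ffin] := pselect (finite_set (supp g));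
  last exact.
exists setT => [|y []//].
suff -> : [set: supp g] = val @^-1` supp g.
  by apply: finite_preimage => // u v _ _; exact: val_inj.
by apply/seteqP; split=> // y _; rewrite /= -in_setE; exact: valP.
Qed.

Lemma fid_finite (f : fob) :
  row_finite (fun x y : supp f =>
    delta (fun e : x = y => idto (congr1 (@fam f) e))).
Proof.
move=> _ x; exists [set x]; first exact: finite_set1.
by move=> y xy; apply: deltaF => /esym.
Qed.

Definition fid (f : fob) : fhom f f := Fhom (@fid_finite f).

(* A [fsbigop] sum, which is 0 by convention on infinite supports; here the
   support is finite for every [x], by row finiteness of [F]. *)
Lemma fcomp_finite (f g h : fob) (G : fhom g h) (F : fhom f g) :
  row_finite (fun x y => \sum_(z \in [set: supp g]) (G z y <o> F x z)).
Proof.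
have /row_finiteP Ffin := @entry_finite _ _ F.
have /row_finiteP Gfin := @entry_finite _ _ G.
apply/row_finiteP => x; have [A Afin FA] := Ffin x.
exists (\bigcup_(z in A) sval (cid2 (Gfin z))).
  by apply: bigcup_finite => // z _; case: cid2.
move=> y yA; apply: fsbig1 => z _.
have [Az|Az] := pselect (A z); last by rewrite FA// comp0r.
case E: (cid2 (Gfin z)) => [B Bfin GB]; rewrite GB ?comp0l// => By.
by apply: yA; exists z => //; rewrite E.
Qed.

Definition fcomp (f g h : fob) (G : fhom g h) (F : fhom f g) : fhom f h :=
  Fhom (fcomp_finite G F).

Definition fcategory : precategory := Precategory fid fcomp.

Section Tensor.
Variables (gamma : S0 * S0 -> S0) (pt : S0).

(* The coordinates of a point of gamma(A x B). They are unambiguous as soon as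
   gamma is injective, see [coord1K] and [coord2K]. *)
Section Coordinates.
Variables A B : set S0.
Implicit Type u : gamma @` (A `*` B).

Lemma coord_ex u : exists p : A * B, gamma (val p.1, val p.2) = val u.
Proof.
have := valP u; rewrite in_setE => -[[x y] [/= Ax By] <-].
by exists (SigSub (mem_set Ax), SigSub (mem_set By)).
Qed.

Definition coord1 u : A := (sval (cid (coord_ex u))).1.
Definition coord2 u : B := (sval (cid (coord_ex u))).2.

Lemma coordK u : gamma (val (coord1 u), val (coord2 u)) = val u.
Proof. by rewrite /coord1 /coord2; case: cid. Qed.

Lemma coord1K u (x : A) (y : B) :
  injective gamma -> val u = gamma (val x, val y) -> coord1 u = x.
Proof. by move=> gi; rewrite -coordK => /gi [/val_inj]. Qed.

Lemma coord2K u (x : A) (y : B) :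
  injective gamma -> val u = gamma (val x, val y) -> coord2 u = y.
Proof. by move=> gi; rewrite -coordK => /gi [_ /val_inj]. Qed.

Lemma coord_inj u v : coord1 u = coord1 v -> coord2 u = coord2 v -> u = v.
Proof. by move=> e1 e2; apply: val_inj; rewrite -!coordK e1 e2. Qed.

Lemma finite_coord (P : set A) (Q : set B) : finite_set P -> finite_set Q ->
  finite_set [set u | P (coord1 u) /\ Q (coord2 u)].
Proof.
move=> Pfin Qfin.
apply: (@finite_preimage _ _ (P `*` Q) (fun u => (coord1 u, coord2 u))).
  by move=> u v _ _ []; exact: coord_inj.
exact: finite_setX.
Qed.

End Coordinates.

Definition ften (f g : fob) : fob :=
  @Fob (gamma @` (supp f `*` supp g))
    (fun u => f (coord1 u) <x> g (coord2 u)).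

Definition funit : fob := @Fob [set pt] (fun=> munit).

Lemma ftenm_finite (f g f' g' : fob) (F : fhom f f') (G : fhom g g') :
  @row_finite (ften f g) (ften f' g')
    (fun u v => F (coord1 u) (coord1 v) <#> G (coord2 u) (coord2 v)).
Proof.
have /row_finiteP Ffin := @entry_finite _ _ F.
have /row_finiteP Gfin := @entry_finite _ _ G.
apply/row_finiteP => u.
have [P Pfin FP] := Ffin (coord1 u); have [Q Qfin GQ] := Gfin (coord2 u).
exists [set v | P (coord1 v) /\ Q (coord2 v)]; first exact: finite_coord.
move=> v /not_andP[nP|nQ]; first by rewrite FP// tensor0l.
by rewrite GQ// tensor0r.
Qed.

Definition ftenm (f g f' g' : fob) (F : fhom f f') (G : fhom g g') :
  fhom (ften f g) (ften f' g') := Fhom (ftenm_finite F G).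

Section Constraints.
Variables f g h : fob.

Lemma fassoc_ob (x x' : supp f) (y y' : supp g) (z z' : supp h) :
  [/\ x = x', y = y' & z = z'] ->
  (f x <x> g y) <x> h z = f x' <x> (g y' <x> h z').
Proof. by move=> [-> -> ->]; exact: (strict_obA (sma_strict C)). Qed.

Lemma fassoc_finite :
  @row_finite (ften (ften f g) h) (ften f (ften g h))
    (fun u v => delta (fun e : [/\ coord1 (coord1 u) = coord1 v,
                                   coord2 (coord1 u) = coord1 (coord2 v)
                                 & coord2 u = coord2 (coord2 v)] =>
       idto (fassoc_ob e))).
Proof.
apply/row_finiteP => u.
exists [set v | coord1 v = coord1 (coord1 u) /\
  [set w | w = coord2 (coord1 u)] (coord1 (coord2 v)) /\
  [set w | w = coord2 u] (coord2 (coord2 v))].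
  have := finite_coord (finite_set1 (coord2 (coord1 u)))
                       (finite_set1 (coord2 u)).
  exact: (finite_coord (finite_set1 (coord1 (coord1 u)))).
by move=> v nv; apply: deltaF => -[e1 e2 e3]; apply: nv.
Qed.

Definition fassoc : fhom (ften (ften f g) h) (ften f (ften g h)) :=
  Fhom fassoc_finite.

Lemma frunit_ob (x x' : supp f) : x = x' -> f x <x> munit = f x'.
Proof. by move=> ->; exact: (strict_ob1r (sma_strict C)). Qed.

Lemma frunit_finite :
  @row_finite (ften f funit) f
    (fun u x' => delta (fun e : coord1 u = x' => idto (frunit_ob e))).
Proof.
move=> _ u; exists [set coord1 u]; first exact: finite_set1.
by move=> y uy; apply: deltaF => /esym.
Qed.

Definition frunit : fhom (ften f funit) f := Fhom frunit_finite.

Lemma flunit_ob (x x' : supp f) : x = x' -> munit <x> f x = f x'.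
Proof. by move=> ->; exact: (strict_ob1l (sma_strict C)). Qed.

Lemma flunit_finite :
  @row_finite (ften funit f) f
    (fun u x' => delta (fun e : coord2 u = x' => idto (flunit_ob e))).
Proof.
move=> _ u; exists [set coord2 u]; first exact: finite_set1.
by move=> y uy; apply: deltaF => /esym.
Qed.

Definition flunit : fhom (ften funit f) f := Fhom flunit_finite.

End Constraints.

Definition fmonoidal : premonoidal :=
  @Premonoidal fcategory ften ftenm funit fassoc frunit flunit.

End Tensor.
End FunctionCategory.

(* Main.v *)
Require Import Defs.
From mathcomp Require Import all_boot all_order all_algebra.
From mathcomp Require Import all_classical.
Local Open Scope classical_set_scope.
Set Implicit Arguments.
Unset Strict Implicit.
Unset Printing Implicit Defensive.
Import GRing.Theory Defs.
Local Open Scope ring_scope.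

(** A morphism of the function category is a row-finite matrix with entries in
    the hom-groups of C, and composition is matrix multiplication. Two kinds of
    axioms have to be checked.

    The axioms about arbitrary morphisms alone, associativity of composition
    ([fcompA]) and the interchange law ([ftenm_comp]), are the usual
    manipulations of double sums. Row finiteness of the first matrices applied
    confines each sum to a finite index set, after which bilinearity of the
    composition and of the tensor product of C, and an exchange of sums or a
    reindexing of pairs along gamma, reduce the claim to the same axiom of C.

    All other axioms involve identities or constraints. Identities,
    associators and units are matrices of one special form: they are carried by
    a map phi between the index sets, and since C is strict, the entry at (x, phi x) is an identity
    of C transported along an equality of objects, all other entries being
    zero. This is the predicate [relabels]. Such a matrix is determined by phi
    alone ([relabels_eq]), because two transported identities with the same
    source and target agree. Moreover relabellings compose
    ([relabels_comp]), tensor ([relabels_ftenm]), and are invertible when phi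
    is bijective ([relabels_iso]). The pentagon and the triangle therefore
    become equalities between maps of index sets, which hold because gamma is
    injective, so that coordinates of gamma(x, y) are well defined. Multiplying
    by a relabelling produces sums with a single term, so naturality of a
    constraint holds as soon as it holds entrywise ([relabels_natural]), where
    it is naturality of the corresponding constraint of C. *)

(** * Finite sums and identities between equal objects *)

(** Finiteness of [A] matters: a sum with infinite support is 0 by convention,
    and phi can make an infinite support finite. *)
Lemma additive_fsum (M N : zmodType) (phi : M -> N) (I : choiceType)
    (A : set I) (F : I -> M) :
  phi 0 = 0 -> {morph phi : a b / a + b} -> finite_set A ->
  phi (\sum_(i \in A) F i) = \sum_(i \in A) phi (F i).
Proof.
by move=> phi0 phiD Afin; rewrite !fsbig_finite// (big_morph phi phiD phi0).
Qed.

Section StrictMonoidalAb.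
Variable C : strict_monoidal_ab.
Implicit Types a b c d : C.

Let Cmon := monoidal_ab_monoidal (sma_monoidal_ab C).
Let Ccat := monoidal_category Cmon.

Lemma comp_fsuml a b c (I : choiceType) (A : set I) (G : I -> hom b c)
    (f : hom a b) :
  finite_set A -> (\sum_(i \in A) G i) <o> f = \sum_(i \in A) (G i <o> f).
Proof.
apply: (additive_fsum (phi := fun g => g <o> f)); first exact: comp0l.
by move=> g g'; exact: compDl (sma_monoidal_ab C) _ _ _ _ _ _.
Qed.

Lemma comp_fsumr a b c (I : choiceType) (A : set I) (F : I -> hom a b)
    (g : hom b c) :
  finite_set A -> g <o> (\sum_(i \in A) F i) = \sum_(i \in A) (g <o> F i).
Proof.
apply: (additive_fsum (phi := fun f => g <o> f)); first exact: comp0r.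
by move=> f f'; exact: compDr (sma_monoidal_ab C) _ _ _ _ _ _.
Qed.

Lemma tensor_fsuml a b a' b' (I : choiceType) (A : set I) (F : I -> hom a a')
    (g : hom b b') :
  finite_set A -> (\sum_(i \in A) F i) <#> g = \sum_(i \in A) (F i <#> g).
Proof.
apply: (additive_fsum (phi := fun f => f <#> g)); first exact: tensor0l.
by move=> f f'; exact: tensorDl (sma_monoidal_ab C) _ _ _ _ _ _ _.
Qed.

Lemma tensor_fsumr a b a' b' (I : choiceType) (A : set I) (f : hom a a')
    (G : I -> hom b b') :
  finite_set A -> f <#> (\sum_(i \in A) G i) = \sum_(i \in A) (f <#> G i).
Proof.
apply: (additive_fsum (phi := fun g => f <#> g)); first exact: tensor0r.
by move=> g g'; exact: tensorDr (sma_monoidal_ab C) _ _ _ _ _ _ _.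
Qed.

Lemma idto_comp a b c (e : b = c) (e' : a = b) :
  idto e <o> idto e' = idto (etrans e' e).
Proof. by case: c / e; case: b / e'; exact: comp_idl Ccat _ _ _. Qed.

(** The target equality is arbitrary, so that the lemma applies whichever proof
    of equality a constraint happens to carry. *)
Lemma idto_tensor a b a' b' (e : a = a') (e' : b = b')
    (e2 : a <x> b = a' <x> b') :
  idto e <#> idto e' = idto e2.
Proof.
case: a' / e e2; case: b' / e' => e2; rewrite (Prop_irrelevance e2 erefl).
exact: tensor_id Cmon _ _.
Qed.

(** This and its two analogues for the units turn any transported identity of
    the right type back into a constraint of C, so that naturality in C can be
    used without tracking equality proofs. *)
Lemma assoc_idto a b c (e : a <x> b <x> c = a <x> (b <x> c)) :
  assoc a b c = idto e.
Proof.
by rewrite (strict_assoc (sma_strict C)); congr idto; exact: Prop_irrelevance.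
Qed.

Lemma runit_idto a (e : a <x> munit = a) : runit a = idto e.
Proof.
by rewrite (strict_runit (sma_strict C)); congr idto; exact: Prop_irrelevance.
Qed.

Lemma lunit_idto a (e : munit <x> a = a) : lunit a = idto e.
Proof.
by rewrite (strict_lunit (sma_strict C)); congr idto; exact: Prop_irrelevance.
Qed.

End StrictMonoidalAb.

Section FunctionCategory.
Variables (C : strict_monoidal_ab) (S0 : choiceType).
Local Notation fob := (fob C S0).
Implicit Types f g h k : fob.

Let Cmon := monoidal_ab_monoidal (sma_monoidal_ab C).
Let Ccat := monoidal_category Cmon.

(** * Row-finite matrices compose associatively *)

Lemma fhom_ext f g (F G : fhom f g) : (forall x y, F x y = G x y) -> F = G.
Proof.
case: F G => [F Ffin] [G Gfin] /= FG.
have {}FG : F = G by apply: functional_extensionality_dep => x;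
  apply: functional_extensionality_dep => y.
by case: G / FG Gfin => Gfin; congr Fhom; exact: Prop_irrelevance.
Qed.

Lemma row_support f g (F : fhom f g) x :
  exists2 A : set (supp g), finite_set A & forall y, ~ A y -> F x y = 0.
Proof. by move: x; apply/row_finiteP; exact: entry_finite. Qed.

(** The composite sums over the whole support of g; taking [A] finite makes
    the sum one that bilinear operations and exchanges of sums respect. *)
Lemma fcomp_fsum f g h (G : fhom g h) (F : fhom f g) x y (A : set (supp g)) :
  (forall z, ~ A z -> G z y <o> F x z = 0) ->
  fcomp G F x y = \sum_(z \in A) (G z y <o> F x z).
Proof.
by move=> A0; rewrite /fcomp /=; apply/esym/fsbig_widen => // z [_] /A0.
Qed.

Lemma fcomp_single f g h (G : fhom g h) (F : fhom f g) x y z :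
  (forall z', z <> z' -> G z' y <o> F x z' = 0) ->
  fcomp G F x y = G z y <o> F x z.
Proof.
move=> z0; rewrite (@fcomp_fsum _ _ _ _ _ _ _ [set z]) ?fsbig_set1//.
by move=> z' zz'; apply: z0 => /esym.
Qed.

Lemma fcompA f g h k (H : fhom h k) (G : fhom g h) (F : fhom f g) :
  fcomp H (fcomp G F) = fcomp (fcomp H G) F.
Proof.
apply: fhom_ext => x w.
have [A Afin FA] := row_support F x.
(* A single finite set serves all the rows of G that F reaches from x. *)
have [B Bfin GB] : exists2 B : set (supp h), finite_set B &
    forall y z, A y -> ~ B z -> G y z = 0.
  exists (\bigcup_(y in A) sval (cid2 (row_support G y))).
    by apply: bigcup_finite => // y _; case: cid2.
  move=> y z Ay Bz; case E: (cid2 (row_support G y)) => [B Bfin GB].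
  by apply: (GB) => Byz; apply: Bz; exists y => //; rewrite E.
have GF z : fcomp G F x z = \sum_(y \in A) (G y z <o> F x y).
  by apply: fcomp_fsum => y /FA ->; exact: comp0r.
have HG y : A y -> fcomp H G y w = \sum_(z \in B) (H z w <o> G y z).
  by move=> Ay; apply: fcomp_fsum => z /(GB _ _ Ay) ->; exact: comp0r.
rewrite (@fcomp_fsum _ _ _ _ _ _ _ B); last first.
  move=> z Bz; rewrite GF fsbig1 ?comp0r// => y Ay.
  by rewrite (GB _ _ Ay Bz) comp0l.
rewrite (@fcomp_fsum _ _ _ _ _ _ _ A); last by move=> y /FA ->; rewrite comp0r.
under eq_fsbigr do rewrite GF comp_fsumr//.
rewrite exchange_fsbig//; apply: eq_fsbigr => y /set_mem Ay.
rewrite HG// comp_fsuml//; apply: eq_fsbigr => z _.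
exact: compA Ccat _ _ _ _ _ _ _.
Qed.

(** * Relabelling morphisms *)

(** The equality of objects is existentially quantified: constraints come with
    different proofs of it, and uniqueness of such proofs makes the choice
    irrelevant. *)
Definition relabels f g (phi : supp f -> supp g) (F : fhom f g) : Prop :=
  forall x, (exists e : f x = g (phi x), F x (phi x) = idto e) /\
            (forall y, phi x <> y -> F x y = 0).

(** The coherence axioms are all proved by this lemma: an equality of
    relabellings is an equality of maps between index sets. *)
Lemma relabels_eq f g (phi psi : supp f -> supp g) (F G : fhom f g) :
  relabels phi F -> relabels psi G -> phi =1 psi -> F = G.
Proof.
move=> Fphi Gpsi phipsi; apply: fhom_ext => x y.
have [[e Fe] F0] := Fphi x; have [[e' Ge] G0] := Gpsi x.
move: (phi x) (psi x) (phipsi x) e e' Fe F0 Ge G0 => z _ <- e e' Fe F0 Ge G0.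
have [<-|zy] := pselect (z = y); last by rewrite F0 ?G0.
by rewrite Fe Ge (Prop_irrelevance e e').
Qed.

(** The form in which the identities and constraints are given: [P] is the
    condition on the indices under which the entry is nonzero, for example a
    conjunction of equalities between coordinates. *)
Lemma relabelsP f g (phi : supp f -> supp g) (F : fhom f g) :
  (forall x y, exists (P : Prop) (m : P -> f x = g y),
     F x y = delta (fun p => idto (m p)) /\ (P <-> phi x = y)) ->
  relabels phi F.
Proof.
move=> Fdelta x; split=> [|y xy].
  have [P [m [-> [_ /(_ erefl) p]]]] := Fdelta x (phi x); exists (m p).
  rewrite /delta; case: pselect => // p'.
  by rewrite (Prop_irrelevance p' p).
by have [P [m [-> [Pxy _]]]] := Fdelta x y; apply: deltaF => /Pxy.
Qed.

Lemma relabel_ex f g (phi : supp f -> supp g) :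
  (forall x, f x = g (phi x)) -> exists F : fhom f g, relabels phi F.
Proof.
move=> e; pose F x y := delta (fun p : phi x = y =>
  idto (etrans (e x) (congr1 (@fam _ _ g) p))).
have Ffin : row_finite F.
  move=> _ x; exists [set phi x]; first exact: finite_set1.
  by move=> y xy; apply: deltaF => /esym.
by exists (Fhom Ffin); apply: relabelsP => x y; do 2 eexists; split.
Qed.

Lemma relabels_fid f : relabels id (fid f).
Proof. by apply: relabelsP => x y; do 2 eexists; split. Qed.
Arguments relabels_fid f : clear implicits.

Lemma fcomp_relabelsr f g h (phi : supp f -> supp g) (G : fhom g h)
    (F : fhom f g) x y :
  relabels phi F -> fcomp G F x y = G (phi x) y <o> F x (phi x).
Proof.
by move=> Fphi; apply: fcomp_single => z /(Fphi x).2 ->; exact: comp0r.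
Qed.

(** Injectivity is what leaves a single term here: column [psi z] of G is
    nonzero exactly on the fibre of [psi] over it. *)
Lemma fcomp_relabelsl f g h (psi : supp g -> supp h) (G : fhom g h)
    (F : fhom f g) x z :
  injective psi -> relabels psi G ->
  fcomp G F x (psi z) = G z (psi z) <o> F x z.
Proof.
move=> psi_inj Gpsi; apply: fcomp_single => z' zz'.
by rewrite (Gpsi z').2 ?comp0l// => /psi_inj/esym.
Qed.

Lemma relabels_comp f g h (phi : supp f -> supp g) (psi : supp g -> supp h)
    (G : fhom g h) (F : fhom f g) :
  relabels psi G -> relabels phi F -> relabels (psi \o phi) (fcomp G F).
Proof.
move=> Gpsi Fphi x; have [[e Fe] _] := Fphi x.
split=> [|y xy]; rewrite ?(fcomp_relabelsr _ _ _ Fphi).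
  have [[e' Ge] _] := Gpsi (phi x); exists (etrans e e').
  by rewrite Fe Ge; exact: idto_comp.
by rewrite (Gpsi _).2 ?comp0l.
Qed.

Lemma relabels_iso f g (phi : supp f -> supp g) (F : fhom f g) :
  bijective phi -> relabels phi F -> @is_iso (fcategory C S0) f g F.
Proof.
move=> [psi phiK psiK] Fphi.
have e y : g y = f (psi y).
  by have [[e _] _] := Fphi (psi y); rewrite e psiK.
have [G Gpsi] := relabel_ex e.
exists G; split.
  exact: relabels_eq (relabels_comp Gpsi Fphi) (relabels_fid f) phiK.
exact: relabels_eq (relabels_comp Fphi Gpsi) (relabels_fid g) psiK.
Qed.

(** Bijectivity of phi' lets every column be written as phi' x', where both
    composites have one term. *)
Lemma relabels_natural f f' g g' (phi : supp f -> supp g)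
    (phi' : supp f' -> supp g') (A : fhom f g) (A' : fhom f' g')
    (F : fhom f f') (G : fhom g g') :
  relabels phi A -> relabels phi' A' -> bijective phi' ->
  (forall x x' (e : f x = g (phi x)) (e' : f' x' = g' (phi' x')),
     idto e' <o> F x x' = G (phi x) (phi' x') <o> idto e) ->
  fcomp A' F = fcomp G A.
Proof.
move=> Aphi Aphi' bij_phi' FG; apply: fhom_ext => x y.
have [psi phiK psiK] := bij_phi'; rewrite -(psiK y).
rewrite (fcomp_relabelsr _ _ _ Aphi).
rewrite (fcomp_relabelsl _ _ _ (bij_inj bij_phi') Aphi').
have [[e ->] _] := Aphi x; have [[e' ->] _] := Aphi' (psi y).
exact: FG.
Qed.

Lemma fcategory_is_category : is_category (fcategory C S0).
Proof.
split=> [f g h k H G F|f g F|f g F]; first exact: fcompA.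
  apply: fhom_ext => x y.
  apply: etrans (fcomp_relabelsl F x y (@inj_id _) (relabels_fid g)) _.
  have [[e ->] _] := relabels_fid g y.
  by rewrite (Prop_irrelevance e erefl); exact: comp_idl Ccat _ _ _.
apply: fhom_ext => x y.
apply: etrans (fcomp_relabelsr F x y (relabels_fid f)) _.
have [[e ->] _] := relabels_fid f x.
by rewrite (Prop_irrelevance e erefl); exact: comp_idr Ccat _ _ _.
Qed.

(** * The tensor product *)

Section Tensor.
Variables (gamma : S0 * S0 -> S0) (pt : S0).
Hypothesis gamma_inj : injective gamma.
Local Notation "f *t g" := (ften gamma f g) (at level 40, left associativity).

Lemma pairing_subproof (A B : set S0) (x : A) (y : B) :
  gamma (val x, val y) \in gamma @` (A `*` B).
Proof.
apply: mem_set; exists (val x, val y) => //.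
by split; apply: set_mem; exact: valP.
Qed.

Definition pairing (A B : set S0) (x : A) (y : B) : gamma @` (A `*` B) :=
  SigSub (pairing_subproof x y).

Lemma pairing1 (A B : set S0) (x : A) (y : B) : coord1 (pairing x y) = x.
Proof. exact: (@coord1K _ _ _ _ (pairing x y) x y). Qed.

Lemma pairing2 (A B : set S0) (x : A) (y : B) : coord2 (pairing x y) = y.
Proof. exact: (@coord2K _ _ _ _ (pairing x y) x y). Qed.

(** Taking coordinates is a bijection from gamma(A x B) to A x B, so a double
    sum is a sum over gamma(A x B). *)
Lemma coord_fsum (M : zmodType) (A B : set S0) (P : set A) (Q : set B)
    (F : A -> B -> M) : finite_set P -> finite_set Q ->
  \sum_(x \in P) \sum_(y \in Q) F x y =
  \sum_(u \in [set u : gamma @` (A `*` B) | P (coord1 u) /\ Q (coord2 u)])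
     F (coord1 u) (coord2 u).
Proof.
move=> Pfin Qfin; rewrite pair_fsbig//.
apply: (reindex_fsbig (fun u => (coord1 u, coord2 u))); split.
- by move=> u [].
- by move=> u v _ _ [] /coord_inj; exact.
- move=> [x y] [/= Px Qy]; exists (pairing x y);
    by rewrite /= ?pairing1 ?pairing2.
Qed.

Lemma ftenm_comp f g h f' g' h' (G : fhom g h) (F : fhom f g)
    (G' : fhom g' h') (F' : fhom f' g') :
  ftenm gamma (fcomp G F) (fcomp G' F') =
  fcomp (ftenm gamma G G') (ftenm gamma F F').
Proof.
apply: fhom_ext => u w.
have [A Afin FA] := row_support F (coord1 u).
have [A' A'fin FA'] := row_support F' (coord2 u).
pose B : set (supp (g *t g')) := [set v | A (coord1 v) /\ A' (coord2 v)].
rewrite [RHS](@fcomp_fsum _ _ _ _ _ _ _ B); last first.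
  move=> v /= /not_andP[nA|nA].
    by rewrite FA// tensor0l comp0r.
  by rewrite FA'// tensor0r comp0r.
rewrite [LHS]/= -[X in X <#> _]/(fcomp G F _ _).
rewrite -[X in _ <#> X]/(fcomp G' F' _ _).
rewrite (@fcomp_fsum _ _ _ _ _ _ _ A); last by move=> y /FA ->; rewrite comp0r.
rewrite (@fcomp_fsum _ _ _ _ _ _ _ A'); last
  by move=> y /FA' ->; rewrite comp0r.
rewrite tensor_fsuml//; under eq_fsbigr do rewrite tensor_fsumr//.
rewrite coord_fsum//; apply: eq_fsbigr => v _.
exact: tensor_comp Cmon _ _ _ _ _ _ _ _ _ _.
Qed.

Definition map_coord (A B A' B' : set S0) (phi : A -> A') (psi : B -> B')
  (u : gamma @` (A `*` B)) : gamma @` (A' `*` B') :=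
  pairing (phi (coord1 u)) (psi (coord2 u)).

Lemma relabels_ftenm f g f' g' (phi : supp f -> supp f')
    (psi : supp g -> supp g') (F : fhom f f') (G : fhom g g') :
  relabels phi F -> relabels psi G ->
  relabels (map_coord phi psi : supp (f *t g) -> supp (f' *t g'))
    (ftenm gamma F G).
Proof.
move=> Fphi Gpsi u; split=> [|v uv] /=.
  (* Coordinates of a pairing equal its components only propositionally, while
     the type of the entry depends on them: variables replace them first. *)
  have entryE x y : x = phi (coord1 u) -> y = psi (coord2 u) ->
      exists e : f (coord1 u) <x> g (coord2 u) = f' x <x> g' y,
        F (coord1 u) x <#> G (coord2 u) y = idto e.
    move=> -> ->.
    have [[e ->] _] := Fphi (coord1 u); have [[e' ->] _] := Gpsi (coord2 u).
    by exists (congr2 tob e e'); exact: idto_tensor.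
  by apply: entryE; [exact: pairing1|exact: pairing2].
have [e1|/(Fphi _).2 ->] := pselect (phi (coord1 u) = coord1 v);
  last exact: tensor0l.
have [e2|/(Gpsi _).2 ->] := pselect (psi (coord2 u) = coord2 v);
  last exact: tensor0r.
by case: uv; apply: coord_inj; rewrite ?pairing1 ?pairing2.
Qed.

Lemma ftenm_id f g : ftenm gamma (fid f) (fid g) = fid (f *t g).
Proof.
apply: relabels_eq (relabels_fid _) _.
  by apply: relabels_ftenm; exact: relabels_fid.
by move=> u; apply: coord_inj; rewrite ?(pairing1, pairing2).
Qed.

(** * The constraints *)

Definition reassoc (A B D : set S0) (u : gamma @` (gamma @` (A `*` B) `*` D)) :
    gamma @` (A `*` (gamma @` (B `*` D))) :=
  pairing (coord1 (coord1 u)) (pairing (coord2 (coord1 u)) (coord2 u)).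

Lemma reassoc_bij (A B D : set S0) : bijective (@reassoc A B D).
Proof.
exists (fun v => pairing (pairing (coord1 v) (coord1 (coord2 v)))
                         (coord2 (coord2 v))) => u;
  by rewrite /reassoc; do !apply: coord_inj; rewrite ?(pairing1, pairing2).
Qed.

Lemma relabels_fassoc f g h :
  @relabels (f *t g *t h) (f *t (g *t h)) (@reassoc _ _ _)
    (fassoc gamma f g h).
Proof.
apply: relabelsP => u v; do 2 eexists; split; first reflexivity.
split=> [[e1 e2 e3]|<-].
  by apply: coord_inj; [|apply: coord_inj]; rewrite ?(pairing1, pairing2).
by rewrite /reassoc !(pairing1, pairing2).
Qed.

Lemma set1_irrelevance (u v : [set pt]) : u = v.
Proof.
apply: val_inj.
by have := set_mem (valP u); have := set_mem (valP v) => /= -> ->.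
Qed.

(** Only one index exists, so the Kronecker symbol in the identity is 1. *)
Lemma fid_funit (u v : supp (funit C pt)) : fid (funit C pt) u v = idm munit.
Proof.
rewrite (set1_irrelevance u v); have [[e ->] _] := relabels_fid (funit C pt) v.
by rewrite (Prop_irrelevance e erefl).
Qed.

Definition point : [set pt] := SigSub (mem_set (erefl pt)).

Lemma coord1_bij (A : set S0) : bijective (@coord1 S0 gamma A [set pt]).
Proof.
exists (fun x => pairing x point) => [u|x]; last exact: pairing1.
by apply: coord_inj; [rewrite pairing1|exact: set1_irrelevance].
Qed.

Lemma coord2_bij (A : set S0) : bijective (@coord2 S0 gamma [set pt] A).
Proof.
exists (fun x => pairing point x) => [u|x]; last exact: pairing2.
by apply: coord_inj; [exact: set1_irrelevance|rewrite pairing2].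
Qed.

Lemma relabels_frunit f :
  @relabels (f *t funit C pt) f (@coord1 _ _ _ _) (frunit gamma pt f).
Proof. by apply: relabelsP => x y; do 2 eexists; split. Qed.

Lemma relabels_flunit f :
  @relabels (funit C pt *t f) f (@coord2 _ _ _ _) (flunit gamma pt f).
Proof. by apply: relabelsP => x y; do 2 eexists; split. Qed.

(** The entries to compare are those of the associativity square of C. *)
Lemma fassoc_natural f g h f' g' h' (F : fhom f f') (G : fhom g g')
    (H : fhom h h') :
  fcomp (fassoc gamma f' g' h') (ftenm gamma (ftenm gamma F G) H) =
  fcomp (ftenm gamma F (ftenm gamma G H)) (fassoc gamma f g h).
Proof.
apply: relabels_natural; [exact: relabels_fassoc|exact: relabels_fassoc|
  exact: reassoc_bij|].
move=> u u' /=.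
(* The coordinates of [reassoc u] and [reassoc u'], which occur in the types of
   the entries, are replaced by variables equal to them. *)
have entryE x y z x' y' z' :
    x = coord1 (coord1 u) -> y = coord2 (coord1 u) -> z = coord2 u ->
    x' = coord1 (coord1 u') -> y' = coord2 (coord1 u') -> z' = coord2 u' ->
    forall
    (e : f (coord1 (coord1 u)) <x> g (coord2 (coord1 u)) <x> h (coord2 u) =
         f x <x> (g y <x> h z))
    (e' : f' (coord1 (coord1 u')) <x> g' (coord2 (coord1 u')) <x>
            h' (coord2 u') =
          f' x' <x> (g' y' <x> h' z')),
  idto e' <o> ((F (coord1 (coord1 u)) (coord1 (coord1 u')) <#>
                G (coord2 (coord1 u)) (coord2 (coord1 u'))) <#>
               H (coord2 u) (coord2 u')) =
  (F x x' <#> (G y y' <#> H z z')) <o> idto e.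
  move=> -> -> -> -> -> -> e e'; rewrite -!assoc_idto.
  exact: assoc_natural Cmon _ _ _ _ _ _ _ _ _.
by apply: entryE; rewrite ?(pairing1, pairing2).
Qed.

Lemma frunit_natural f f' (F : fhom f f') :
  fcomp (frunit gamma pt f') (ftenm gamma F (fid (funit C pt))) =
  fcomp F (frunit gamma pt f).
Proof.
apply: relabels_natural; [exact: relabels_frunit|exact: relabels_frunit|
  exact: coord1_bij|].
move=> u u' e e'.
have -> : ftenm gamma F (fid (funit C pt)) u u' =
    F (coord1 u) (coord1 u') <#> idm munit.
  by congr thom; exact: fid_funit.
rewrite -(runit_idto e) -(runit_idto e').
exact: runit_natural Cmon _ _ _.
Qed.

Lemma flunit_natural f f' (F : fhom f f') :
  fcomp (flunit gamma pt f') (ftenm gamma (fid (funit C pt)) F) =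
  fcomp F (flunit gamma pt f).
Proof.
apply: relabels_natural; [exact: relabels_flunit|exact: relabels_flunit|
  exact: coord2_bij|].
move=> u u' e e'.
have -> : ftenm gamma (fid (funit C pt)) F u u' =
    idm munit <#> F (coord2 u) (coord2 u').
  by congr thom; exact: fid_funit.
rewrite -(lunit_idto e) -(lunit_idto e').
exact: lunit_natural Cmon _ _ _.
Qed.

Lemma fpentagon f g h k :
  fcomp (fcomp (ftenm gamma (fid f) (fassoc gamma g h k))
               (fassoc gamma f (g *t h) k))
        (ftenm gamma (fassoc gamma f g h) (fid k)) =
  fcomp (fassoc gamma f g (h *t k)) (fassoc gamma (f *t g) h k).
Proof.
apply: relabels_eq.
- apply: relabels_comp; first apply: relabels_comp.
  + by apply: relabels_ftenm; [exact: relabels_fid|exact: relabels_fassoc].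
  + exact: relabels_fassoc.
  + by apply: relabels_ftenm; [exact: relabels_fassoc|exact: relabels_fid].
- by apply: relabels_comp; exact: relabels_fassoc.
by move=> u; rewrite /= /map_coord /reassoc !(pairing1, pairing2).
Qed.

Lemma ftriangle f g :
  fcomp (ftenm gamma (fid f) (flunit gamma pt g))
        (fassoc gamma f (funit C pt) g) =
  ftenm gamma (frunit gamma pt f) (fid g).
Proof.
apply: relabels_eq.
- apply: relabels_comp; last exact: relabels_fassoc.
  by apply: relabels_ftenm; [exact: relabels_fid|exact: relabels_flunit].
- by apply: relabels_ftenm; [exact: relabels_frunit|exact: relabels_fid].
by move=> u; rewrite /= /map_coord /reassoc !(pairing1, pairing2).
Qed.

Lemma fassoc_iso f g h :
  @is_iso (fcategory C S0) (f *t g *t h) (f *t (g *t h)) (fassoc gamma f g h).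
Proof.
by apply: relabels_iso; [exact: reassoc_bij|exact: relabels_fassoc].
Qed.

Lemma frunit_iso f :
  @is_iso (fcategory C S0) (f *t funit C pt) f (frunit gamma pt f).
Proof. by apply: relabels_iso; [exact: coord1_bij|exact: relabels_frunit]. Qed.

Lemma flunit_iso f :
  @is_iso (fcategory C S0) (funit C pt *t f) f (flunit gamma pt f).
Proof. by apply: relabels_iso; [exact: coord2_bij|exact: relabels_flunit]. Qed.

End Tensor.
End FunctionCategory.

Unset Implicit Arguments.

Theorem theorem1p3 (C : strict_monoidal_ab) (S0 : choiceType)
    (S0_infinite : infinite_set [set: S0])
    (gamma : S0 * S0 -> S0) (gamma_bij : bijective gamma) (pt : S0) :
  is_monoidal (@fmonoidal C S0 gamma pt).
Proof.
have gi := bij_inj gamma_bij; split.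
- exact: fcategory_is_category.
- by move=> f g; exact: ftenm_id.
- by move=> f g h f' g' h' G F G' F'; exact: ftenm_comp.
- by move=> f g h; exact: fassoc_iso.
- by move=> f; exact: frunit_iso.
- by move=> f; exact: flunit_iso.
- by move=> f g h f' g' h' F G H; exact: fassoc_natural.
- by move=> f f' F; exact: frunit_natural.
- by move=> f f' F; exact: flunit_natural.
- by move=> f g h k; exact: fpentagon.
- by move=> f g; exact: ftriangle.
Qed.
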